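(* Suppose that $K$ is closed at infinity and that $\mathbf{x}^*$ is a minimizer of the problem $\inf\{f(\mathbf{x}) : \mathbf{x}\in K\}$. Let $f^{(\epsilon)}$ be the optimal value of the sparse homogenized reformulation with perturbation parameter $\epsilon$. For every $\epsilon>0$, the following holds: $$f_{\min}< f^{(\epsilon)}\leq f_{\min}+ \epsilon \cdot p \cdot \left(1+\|\mathbf{x}^*\|^2\right)^{\frac{d}{2}}.$$ Moreover, one has $f^{(\epsilon)}=f_{\min}$ when $\epsilon =0$.
   Context: Polynomial optimization problem (POP). Let $\mathbf{x}=(x_1,\dots,x_n)$, let $f,g_1,\dots,g_m\in\mathbb{R}[\mathbf{x}]$, let $K=\{\mathbf{x}\in\mathbb{R}^n : g_j(\mathbf{x})\ge 0,\ j=1,\dots,m\}$, and let $f_{\min}=\inf_{\mathbf{x}\in K} f(\mathbf{x})$. It is assumed throughout that $f_{\min}>-\infty$. Put $d=\deg(f)$ and $d_0=2\lceil d/2\rceil$. The symbol $\|\cdot\|$ denotes the Euclidean norm. Homogenization. Let $\tilde{\mathbf{x}}=(x_0,x_1,\dots,x_n)$. For a polynomial $q\in\mathbb{R}[\mathbf{x}]$, $\tilde q(\tilde{\mathbf{x}})=x_0^{\deg(q)}q(\mathbf{x}/x_0)$ is its homogenization. Define $$\widetilde K=\{\tilde{\mathbf{x}}\in\mathbb{R}^{n+1} : \tilde g_j(\tilde{\mathbf{x}})\ge 0\ (j=1,\dots,m),\ x_0\ge 0,\ \|\tilde{\mathbf{x}}\|^2=1\}.$$ $K$ is said to be closed at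 infinity if $\widetilde K$ equals the closure of $\widetilde K\cap\{\tilde{\mathbf{x}}\in\mathbb{R}^{n+1} : x_0>0\}$. Correlative sparsity. Sets of variables $\mathbf{x}(1),\dots,\mathbf{x}(p)\subseteq\{x_1,\dots,x_n\}$ with $\bigcup_{\ell=1}^p\mathbf{x}(\ell)=\{x_1,\dots,x_n\}$ form a correlative sparsity pattern (csp) of the POP if $f=\sum_{\ell=1}^p f_\ell$ with $f_\ell\in\mathbb{R}[\mathbf{x}(\ell)]$, and there is a partition $\{J_1,\dots,J_p\}$ of $\{1,\dots,m\}$ with $g_j\in\mathbb{R}[\mathbf{x}(\ell)]$ for every $\ell$ and every $j\in J_\ell$. Here $(\mathbf{x}(1),\dots,\mathbf{x}(p))$ is a csp of the POP. Sparse homogenized reformulation with perturbations. Let $\tilde{\mathbf{x}}(\ell)=(x_0,\mathbf{x}(\ell))$, let $\mathbf{w}=(w_1,\dots,w_p)$ be auxiliary variables, and let $$\widetilde K_s^1=\{(\tilde{\mathbf{x}},\mathbf{w})\in\mathbb{R}^{n+1+p} : x_0\ge0,\ \tilde g_j(\tilde{\mathbf{x}})\ge0\ (j=1,\dots,m),\ \|\tilde{\mathbf{x}}(\ell)\|^2+w_\ell^2=1\ (\ell=1,\dots,p)\}.$$ For $\epsilon\ge0$, the reformulation is to maximize $\gamma$ subject to $$\tilde f(\tilde{\mathbf{x}})+\epsilon\Big(\sum_{i=0}^n x_i^{d_0}+\sum_{\ell=1}^p w_\ell^{d_0}\Big)-\gamma x_0^d\ge 0\quad\text{for all }(\tilde{\mathbf{x}},\mathbf{w})\in\widetilde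 K_s^1,$$ and its optimal value $f^{(\epsilon)}$ is the supremum of all such $\gamma\in\mathbb{R}$.
   Formalization: The upper bound is stated only for nonconstant f (d ≥ 1): for constant f one has d_0 = 0, every power equals 1, and f^(ε) = f_min + ε(n+1+p) exceeds f_min + εp, so the printed bound fails. *)

(* Defs.v *)
From HB Require Import structures.
From mathcomp Require Import all_boot all_order all_algebra.
From mathcomp Require Import all_classical all_reals all_analysis.
(* The notations of multinomials conflict with those of MathComp-Analysis. *)
From mathcomp Require Import -(notations) mpoly.

Set Implicit Arguments.
Unset Strict Implicit.
Unset Printing Implicit Defensive.

Import Order.TTheory GRing.Theory Num.Theory.
Import numFieldNormedType.Exports.

Local Open Scope classical_set_scope.
Local Open Scope ring_scope.

Notation "{ 'mpoly' R [ n ] }" := (mpoly n R)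
  (at level 0, R at level 2, n at level 2, format "{ 'mpoly'  R [ n ] }").

(* Points of R^N are row vectors: their type carries the product topology,
   which is the Euclidean one, but its built-in norm is the max norm. *)
Definition peval (R : realType) (N : nat) (q : {mpoly R[N]}) (x : 'rV[R]_N) : R :=
  meval (fun i => x ord0 i) q.

(* [enorm_on A x] is the Euclidean norm of the subvector of [x] indexed by
   [A]. *)
Definition enorm_on (R : realType) (N : nat) (A : {set 'I_N}) (x : 'rV[R]_N) : R :=
  Num.sqrt (\sum_(i in A) x ord0 i ^+ 2).

Definition enorm (R : realType) (N : nat) (x : 'rV[R]_N) : R :=
  enorm_on [set: 'I_N]%SET x.

(* Total degree, with the convention that the zero polynomial has degree 0. *)
Definition pdeg (R : realType) (N : nat) (q : {mpoly R[N]}) : nat := (msize q).-1.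

(* [d0 = 2 * ceil (d / 2)] *)
Definition even_pdeg (R : realType) (N : nat) (q : {mpoly R[N]}) : nat :=
  (2 * uphalf (pdeg q))%N.

Definition only_vars (R : realType) (N : nat) (A : {set 'I_N}) (q : {mpoly R[N]}) : Prop :=
  forall m, m \in msupp q -> forall i : 'I_N, m i != 0%N -> i \in A.

(* Among the [n.+1] homogeneous coordinates, [x_0] has index [ord0] and the
   i-th original variable has index [lift ord0 i]. *)
Definition homog (R : realType) (n : nat) (q : {mpoly R[n]}) : {mpoly R[n.+1]} :=
  \sum_(m <- msupp q)
    mcoeff m q *: (mpolyX R (mnm1 ord0) ^+ (pdeg q - mdeg m)
                   * \prod_(i < n) mpolyX R (mnm1 (lift ord0 i)) ^+ m i).

Lemma peval_homog (R : realType) (n : nat) (q : {mpoly R[n]}) (x : 'rV[R]_n.+1) :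
  x ord0 ord0 != 0 ->
  peval (homog q) x =
  x ord0 ord0 ^+ pdeg q * peval q (\row_i (x ord0 (lift ord0 i) / x ord0 ord0)).
Proof.
move=> x0; rewrite /peval /homog raddf_sum /= [in RHS]mevalE mulr_sumr.
rewrite !big_seq; apply: eq_bigr => m mq.
have mdeg_le : (mdeg m <= pdeg q)%N.
  by rewrite /pdeg -ltnS (leq_trans (msize_mdeg_lt mq)) // leqSpred.
rewrite mevalZ mevalM rmorph_prod rmorphXn /= mevalXU [RHS]mulrCA.
congr (_ * _); rewrite -[in RHS](subnK mdeg_le) exprD -mulrA; congr (_ * _).
rewrite mdegE -prodrXr -big_split /=; apply: eq_bigr => i _.
by rewrite rmorphXn /= mevalXU mxE -exprMn mulrC divfK.
Qed.

Section POP.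
Variables (R : realType) (n m : nat).
Implicit Types (f : {mpoly R[n]}) (g : 'I_m -> {mpoly R[n]}).

Definition feasible g : set 'rV[R]_n :=
  [set x | forall j, 0 <= peval (g j) x].

Definition fmin f g : \bar R :=
  ereal_inf [set (peval f x)%:E | x in feasible g].

Definition is_minimizer f g (xs : 'rV[R]_n) : Prop :=
  feasible g xs /\ forall x, feasible g x -> peval f xs <= peval f x.

Definition hfeasible g : set 'rV[R]_n.+1 :=
  [set x | [/\ forall j, 0 <= peval (homog (g j)) x,
               0 <= x ord0 ord0 & enorm x ^+ 2 = 1]].

Definition closed_at_infinity g : Prop :=
  hfeasible g = closure (hfeasible g `&` [set x : 'rV[R]_n.+1 | 0 < x ord0 ord0]).

Variable p : nat.

(* [X l] is the index set of the variables x(l).  The blocks [J l] of the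
   partition of the constraints may be empty. *)
Definition is_csp f g (X : 'I_p -> {set 'I_n}) : Prop :=
  [/\ (\bigcup_(l < p) X l = [set: 'I_n])%SET,
      exists fs : 'I_p -> {mpoly R[n]},
        f = \sum_(l < p) fs l /\ forall l, only_vars (X l) (fs l)
    & exists J : 'I_p -> {set 'I_m},
        [/\ (\bigcup_(l < p) J l = [set: 'I_m])%SET,
            forall l k, l != k -> (J l :&: J k)%SET = finset.set0
          & forall l j, j \in J l -> only_vars (X l) (g j)]].

Definition hvars (A : {set 'I_n}) : {set 'I_n.+1} :=
  (ord0 |: [set lift ord0 i | i in A])%SET.

Definition sparse_hfeasible g (X : 'I_p -> {set 'I_n}) :
    set ('rV[R]_n.+1 * 'rV[R]_p) :=
  [set xw : 'rV[R]_n.+1 * 'rV[R]_p |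
    [/\ 0 <= xw.1 ord0 ord0,
        forall j, 0 <= peval (homog (g j)) xw.1
      & forall l, enorm_on (hvars (X l)) xw.1 ^+ 2 + xw.2 ord0 l ^+ 2 = 1]].

Definition perturbed_feasible f g (X : 'I_p -> {set 'I_n}) (eps : R) : set R :=
  [set gamma | forall xw : 'rV[R]_n.+1 * 'rV[R]_p, sparse_hfeasible g X xw ->
     0 <= peval (homog f) xw.1
          + eps * (\sum_(i < n.+1) xw.1 ord0 i ^+ even_pdeg f
                   + \sum_(l < p) xw.2 ord0 l ^+ even_pdeg f)
          - gamma * xw.1 ord0 ord0 ^+ pdeg f].

Definition perturbed_value f g (X : 'I_p -> {set 'I_n}) (eps : R) : \bar R :=
  ereal_sup [set gamma%:E | gamma in perturbed_feasible f g X eps].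

End POP.

(* Main.v *)
Require Import Defs.
From mathcomp Require Import all_boot all_order all_algebra.
From mathcomp Require Import all_classical all_reals all_analysis.
From mathcomp Require Import -(notations) mpoly.
Import Order.TTheory GRing.Theory Num.Theory.
Import numFieldNormedType.Exports.
Local Open Scope ring_scope.

(** Write [f~] for the homogenization [homog f], [d] for its degree and [c] for
    the minimum [f xs].  Everything rests on one inequality
    ([homog_ge_of_closed_at_infinity]): if [K] is closed at infinity, then
    [f~ x >= c * x_0 ^ d] on the whole cone [x_0 >= 0, g~_j x >= 0].  For
    [x_0 > 0] this is just [f >= c] at the feasible point [x / x_0]; the points
    with [x_0 = 0] are reached by normalizing to the unit sphere, where closedness
    at infinity makes them limits of points with [x_0 > 0].

    The lower bounds follow.  For [eps = 0] the inequality says that [c] itself is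
    admissible in the sparse reformulation.  For [eps > 0] the perturbation is
    bounded away from [0] relative to [x_0 ^ d]
    ([perturbation_lower_bound]): on each block the coordinates lie on a unit
    sphere, so they cannot all be small.  Hence [c + delta] is admissible for some
    [delta > 0].

    The upper bounds come from testing the constraint at one point: the lift
    [(1, xs)] rescaled to the unit sphere, completed by the slack variables [w].
    At that point [f~ x = c * x_0 ^ d] with [x_0 = (1 + |xs|^2)^(-1/2)], and the
    perturbation, whose exponent is at least [2] once [d > 0], is at most the sum
    over the blocks of the left-hand sides of the sphere equations, that is [p]
    ([perturbation_upper_bound]). *)

(** * Polynomial evaluation and homogenization *)

Lemma peval_continuous (R : realType) (N : nat) (q : {mpoly R[N]}) :
  continuous (peval q : 'rV[R]_N -> R).
Proof.
have -> : (peval q : 'rV[R]_N -> R) =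
  (fun x => \sum_(m <- msupp q) mcoeff m q * \prod_i x ord0 i ^+ m i).
  by apply/funext => x; rewrite /peval mevalE.
apply: (@continuous_big R _ +%R 0 xpredT) => [|m _].
  exact: (@add_continuous R^o).
move=> x; apply: continuousM; first exact: cst_continuous.
move: x; apply: (@continuous_big R _ *%R 1 xpredT); first exact: mul_continuous.
move=> i _ {}x.
apply: (@continuous_comp _ _ _ (fun y : 'rV[R]_N => y ord0 i) (fun t => t ^+ m i)).
  exact: coord_continuous.
exact: exprn_continuous.
Qed.

Lemma peval_homogZ (R : realType) (n : nat) (q : {mpoly R[n]}) (t : R)
    (x : 'rV[R]_n.+1) :
  peval (homog q) (t *: x) = t ^+ pdeg q * peval (homog q) x.
Proof.
rewrite /peval /homog !raddf_sum /= mulr_sumr !big_seq.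
apply: eq_bigr => m mq.
have mdeg_le : (mdeg m <= pdeg q)%N.
  by rewrite /pdeg -ltnS (leq_trans (msize_mdeg_lt mq)) // leqSpred.
rewrite !mevalZ !mevalM !rmorph_prod !rmorphXn /= !mevalXU [RHS]mulrCA.
congr (_ * _); rewrite mxE exprMn -[in t ^+ pdeg q](subnK mdeg_le) exprD.
rewrite -!mulrA; congr (_ * _); rewrite [RHS]mulrCA; congr (_ * _).
rewrite mdegE -prodrXr -big_split /=; apply: eq_bigr => i _.
by rewrite !rmorphXn /= !mevalXU mxE exprMn.
Qed.

Lemma pdeg_no_vars (R : realType) (q : {mpoly R[0]}) : pdeg q = 0%N.
Proof.
apply/eqP; rewrite /pdeg -leqn0 -subn1 leq_subLR addn0 msizeE.
by apply/bigmax_leqP_seq => m _ _; rewrite ltnS leqn0 mdegE big_ord0.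
Qed.

Definition lift_point {R : realType} {n : nat} (x : 'rV[R]_n) : 'rV[R]_n.+1 :=
  \row_i oapp (x ord0) 1 (unlift ord0 i).

Lemma lift_point0 (R : realType) (n : nat) (x : 'rV[R]_n) :
  lift_point x ord0 ord0 = 1.
Proof. by rewrite mxE unlift_none. Qed.

Lemma lift_pointS (R : realType) (n : nat) (x : 'rV[R]_n) (i : 'I_n) :
  lift_point x ord0 (lift ord0 i) = x ord0 i.
Proof. by rewrite mxE liftK. Qed.

Lemma peval_homog_lift_point (R : realType) (n : nat) (q : {mpoly R[n]})
    (x : 'rV[R]_n) :
  peval (homog q) (lift_point x) = peval q x.
Proof.
rewrite peval_homog lift_point0 ?oner_neq0 // expr1n mul1r; congr peval.
by apply/rowP => i; rewrite mxE lift_pointS divr1.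
Qed.

(** * Euclidean norms of subvectors *)

Lemma enorm_on_sqr (R : realType) (N : nat) (A : {set 'I_N}) (x : 'rV[R]_N) :
  enorm_on A x ^+ 2 = \sum_(i in A) x ord0 i ^+ 2.
Proof. by rewrite /enorm_on sqr_sqrtr // sumr_ge0 // => i _; exact: sqr_ge0. Qed.

Lemma enorm_sqr (R : realType) (N : nat) (x : 'rV[R]_N) :
  enorm x ^+ 2 = \sum_i x ord0 i ^+ 2.
Proof. by rewrite /enorm enorm_on_sqr; apply: eq_bigl => i; rewrite inE. Qed.

Lemma enorm_sqr_gt0 (R : realType) (N : nat) (x : 'rV[R]_N) :
  x != 0 -> 0 < enorm x ^+ 2.
Proof.
move=> x0; rewrite lt_def sqr_ge0 andbT; apply: contra x0 => /eqP.
rewrite enorm_sqr => /eqP; rewrite psumr_eq0 => [/allP h|i _]; last exact: sqr_ge0.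
by apply/eqP/rowP => i; rewrite mxE; apply/eqP; rewrite -sqrf_eq0 (implyP (h i _)) ?mem_index_enum.
Qed.

Lemma enorm_sqrZ (R : realType) (N : nat) (t : R) (x : 'rV[R]_N) :
  enorm (t *: x) ^+ 2 = t ^+ 2 * enorm x ^+ 2.
Proof.
by rewrite !enorm_sqr mulr_sumr; apply: eq_bigr => i _; rewrite mxE exprMn.
Qed.

Lemma enorm_sqr_lift_point (R : realType) (n : nat) (x : 'rV[R]_n) :
  enorm (lift_point x) ^+ 2 = 1 + enorm x ^+ 2.
Proof.
rewrite !enorm_sqr big_ord_recl lift_point0 expr1n; congr (_ + _).
by apply: eq_bigr => i _; rewrite lift_pointS.
Qed.

(** * The homogenized objective on the cone over the feasible set *)

(** The continuity argument only applies to unit vectors, so a nonzero [x] is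
    first rescaled.  The apex [x = 0] is written as [0 *: lift_point xs], which
    treats constant and nonconstant [f] alike since [0 ^+ 0 = 1]. *)
Lemma homog_ge_of_closed_at_infinity {R : realType} {n m : nat}
    {f : {mpoly R[n]}} {g : 'I_m -> {mpoly R[n]}} {xs : 'rV[R]_n} :
  closed_at_infinity g -> is_minimizer f g xs ->
  forall x : 'rV[R]_n.+1, 0 <= x ord0 ord0 ->
    (forall j, 0 <= peval (homog (g j)) x) ->
    peval f xs * x ord0 ord0 ^+ pdeg f <= peval (homog f) x.
Proof.
move=> closedK [xsK xs_min].
have scale t (x : 'rV[R]_n.+1) : 0 <= t ->
    peval f xs * x ord0 ord0 ^+ pdeg f <= peval (homog f) x ->
    peval f xs * (t *: x) ord0 ord0 ^+ pdeg f <= peval (homog f) (t *: x).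
  by move=> t0 h; rewrite peval_homogZ mxE exprMn mulrCA ler_wpM2l // exprn_ge0.
have affine (x : 'rV[R]_n.+1) : 0 < x ord0 ord0 ->
    (forall j, 0 <= peval (homog (g j)) x) ->
    peval f xs * x ord0 ord0 ^+ pdeg f <= peval (homog f) x.
  move=> x0 gx; rewrite peval_homog ?gt_eqF // mulrC ler_pM2l ?exprn_gt0 //.
  apply: xs_min => j; have := gx j; rewrite peval_homog ?gt_eqF //.
  by rewrite pmulr_rge0 // exprn_gt0.
have sphere (x : 'rV[R]_n.+1) : hfeasible g x ->
    peval f xs * x ord0 ord0 ^+ pdeg f <= peval (homog f) x.
  rewrite closedK => clx; rewrite -subr_ge0.
  pose h (y : 'rV[R]_n.+1) := peval (homog f) y - peval f xs * y ord0 ord0 ^+ pdeg f.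
  have hcont : continuous h.
    move=> y; apply: continuousB; first exact: peval_continuous.
    apply: continuousM; first exact: cst_continuous.
    apply: (@continuous_comp _ _ _ (fun y : 'rV[R]_n.+1 => y ord0 ord0)
              (fun t => t ^+ pdeg f)).
      exact: coord_continuous.
    exact: exprn_continuous.
  have closed_h : closed (h @^-1` [set t | 0 <= t])%classic.
    by apply: preimage_closed; [move=> ? _; exact: hcont | exact: closed_ge].
  apply: closed_h; apply: closureS clx => y [[gy _ _] y0] /=.
  by rewrite /h subr_ge0; exact: affine.
move=> x x0 gx; have [->|xn0] := eqVneq x 0.
  rewrite -(scale0r (lift_point xs)); apply: scale => //.
  apply: affine; first by rewrite lift_point0.
  by move=> j; rewrite peval_homog_lift_point; exact: xsK.
have N0 : 0 < enorm x.
  by rewrite lt_def sqrtr_ge0 andbT -sqrf_eq0 gt_eqF // enorm_sqr_gt0.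
rewrite -[x]scale1r -(divff (lt0r_neq0 N0)) -scalerA.
apply: scale; first exact: ltW.
apply: sphere; split=> [j||].
- by rewrite peval_homogZ mulr_ge0 // exprn_ge0 // invr_ge0 ltW.
- by rewrite mxE mulr_ge0 // invr_ge0 ltW.
- by rewrite enorm_sqrZ exprVn mulVf // expf_neq0 // gt_eqF.
Qed.

(** * The sparse spheres and the perturbation *)

Lemma in_some_hvars {n p : nat} {X : 'I_p -> {set 'I_n}} (l0 : 'I_p) :
  (\bigcup_(l < p) X l = [set: 'I_n])%SET ->
  forall i : 'I_n.+1, exists l, i \in hvars (X l).
Proof.
move=> cover i; case: (unliftP ord0 i) => [k ->|->]; last first.
  by exists l0; rewrite finset.setU11.
have : k \in (\bigcup_(l < p) X l)%SET by rewrite cover finset.inE.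
by case/bigcupP => l _ kl; exists l; rewrite finset.inE imset_f // orbT.
Qed.

(** A nonconstant polynomial has a variable, and only a block can cover it. *)
Lemma blocks_gt0_of_pdeg_gt0 {R : realType} {n p : nat} {X : 'I_p -> {set 'I_n}}
    {f : {mpoly R[n]}} :
  (\bigcup_(l < p) X l = [set: 'I_n])%SET -> (0 < pdeg f)%N -> (0 < p)%N.
Proof.
move=> cover; rewrite !lt0n; apply: contra => /eqP p0.
have : #|[set: 'I_n]| = 0%N.
  apply/eqP; rewrite cards_eq0 -cover big1 // => l _.
  by have := ltn_ord l; rewrite [X in (_ < X)%N]p0.
rewrite cardsT card_ord => n0; move: f; rewrite n0 => f; exact/eqP/pdeg_no_vars.
Qed.

(** The slack variables [w] turn the inequality [|x(l)|^2 <= 1], which any point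
    of the unit ball satisfies on every block, into the sphere equations. *)
Lemma sparse_lift_exists (R : realType) (n m p : nat)
    (g : 'I_m -> {mpoly R[n]}) (X : 'I_p -> {set 'I_n}) (x : 'rV[R]_n.+1) :
  0 <= x ord0 ord0 -> (forall j, 0 <= peval (homog (g j)) x) ->
  enorm x ^+ 2 <= 1 -> exists w : 'rV[R]_p, sparse_hfeasible g X (x, w).
Proof.
move=> x0 gx x1.
exists (\row_l Num.sqrt (1 - enorm_on (hvars (X l)) x ^+ 2)).
split=> //= l; rewrite mxE [X in _ + X]sqr_sqrtr ?subrKC //.
rewrite subr_ge0; apply: le_trans x1; rewrite enorm_on_sqr enorm_sqr big_mkcond /=.
by apply: ler_sum => i _; case: ifP => // _; exact: sqr_ge0.
Qed.

Lemma sparse_coord_sqr_le1 {R : realType} {n m p : nat}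
    {g : 'I_m -> {mpoly R[n]}} {X : 'I_p -> {set 'I_n}}
    {x : 'rV[R]_n.+1} {w : 'rV[R]_p} {l : 'I_p} {i : 'I_n.+1} :
  sparse_hfeasible g X (x, w) -> i \in hvars (X l) -> x ord0 i ^+ 2 <= 1.
Proof.
move=> [/= _ _ sph] il; rewrite -(sph l) enorm_on_sqr (bigD1 i) //= -addrA.
by rewrite lerDl addr_ge0 ?sqr_ge0 // sumr_ge0 // => *; exact: sqr_ge0.
Qed.

(** Summing the [p] sphere equations counts every coordinate of [x] at least
    once, because the blocks cover all of them. *)
Lemma perturbation_upper_bound (R : realType) (n m p : nat)
    (g : 'I_m -> {mpoly R[n]}) (X : 'I_p -> {set 'I_n})
    (x : 'rV[R]_n.+1) (w : 'rV[R]_p) (k : nat) :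
  (0 < p)%N -> (\bigcup_(l < p) X l = [set: 'I_n])%SET -> (0 < k)%N ->
  sparse_hfeasible g X (x, w) ->
  \sum_(i < n.+1) x ord0 i ^+ (2 * k) + \sum_(l < p) w ord0 l ^+ (2 * k) <= p%:R.
Proof.
move=> p0 cover k0 xw; have [/= _ _ sph] := xw.
have covered := in_some_hvars (Ordinal p0) cover.
have pow_le (t : R) : t ^+ 2 <= 1 -> t ^+ (2 * k) <= t ^+ 2.
  by move=> t1; rewrite exprM ler_iXnr // ?sqr_ge0.
have x_le1 i : x ord0 i ^+ 2 <= 1.
  by have [l il] := covered i; exact: sparse_coord_sqr_le1 xw il.
have w_le1 l : w ord0 l ^+ 2 <= 1 by rewrite -(sph l) lerDr sqr_ge0.
have -> : p%:R = \sum_(l < p) (enorm_on (hvars (X l)) x ^+ 2 + w ord0 l ^+ 2).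
  by rewrite (eq_bigr (fun=> 1)) // sumr_const card_ord.
rewrite big_split /= lerD //; last by apply: ler_sum => l _; exact: pow_le.
apply: (@le_trans _ _ (\sum_i x ord0 i ^+ 2)).
  by apply: ler_sum => i _; exact: pow_le.
under [leRHS]eq_bigr do rewrite enorm_on_sqr big_mkcond /=.
rewrite exchange_big /=; apply: ler_sum => i _.
have [l il] := covered i; rewrite (bigD1 l) //= il lerDl sumr_ge0 // => l' _.
by case: ifP => // _; exact: sqr_ge0.
Qed.

(** On the unit sphere of a single block, one of the at most [n + 2] squares is
    at least [1 / (n + 2)]. *)
Lemma perturbation_lower_bound {R : realType} {n m p : nat}
    {g : 'I_m -> {mpoly R[n]}} {X : 'I_p -> {set 'I_n}}
    {x : 'rV[R]_n.+1} {w : 'rV[R]_p} (k : nat) :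
  (0 < p)%N -> sparse_hfeasible g X (x, w) ->
  n.+2%:R^-1 ^+ k <=
    \sum_(i < n.+1) x ord0 i ^+ (2 * k) + \sum_(l < p) w ord0 l ^+ (2 * k).
Proof.
move=> p0 [/= _ _ /(_ (Ordinal p0))]; set l := Ordinal p0 => sph.
have pow_ge0 (t : R) : 0 <= t ^+ (2 * k) by rewrite exprM exprn_ge0 ?sqr_ge0.
set c : R := n.+2%:R^-1.
have c0 : 0 <= c by rewrite invr_ge0.
have pow_ge (t : R) : c <= t ^+ 2 -> c ^+ k <= t ^+ (2 * k).
  by move=> ct; rewrite exprM lerXn2r // nnegrE ?sqr_ge0.
(* If every square on the block were below [c], they would sum to less than
   [(n + 2) * c = 1]. *)
have [wc|wc] := leP c (w ord0 l ^+ 2).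
  apply: le_trans (pow_ge _ wc) _; rewrite (bigD1 l) //= addrCA lerDl.
  by rewrite addr_ge0 // sumr_ge0.
have [[i xc]|xc] := pselect (exists i, c <= x ord0 i ^+ 2).
  apply: le_trans (pow_ge _ xc) _; rewrite (bigD1 i) //= -addrA lerDl.
  by rewrite addr_ge0 // sumr_ge0.
have xlt i : x ord0 i ^+ 2 < c by rewrite ltNge; apply/negP => h; apply: xc; exists i.
suff : enorm_on (hvars (X l)) x ^+ 2 + w ord0 l ^+ 2 < 1 by rewrite sph ltxx.
have -> : 1 = c *+ n.+1 + c :> R.
  by rewrite -mulrSr -[c *+ _]mulr_natr mulVf // pnatr_eq0.
apply: ler_ltD => //; rewrite enorm_on_sqr big_mkcond /=.
rewrite -[n.+1 in leRHS]card_ord -sumr_const.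
by apply: ler_sum => i _; case: ifP => // _; exact: ltW.
Qed.

(** * The perturbed values *)

(** Attainment turns the extended-real infimum into a real number, which can be
    compared with admissible values of [gamma]. *)
Lemma fmin_minimizer {R : realType} {n m : nat} {f : {mpoly R[n]}}
    {g : 'I_m -> {mpoly R[n]}} {xs : 'rV[R]_n} :
  is_minimizer f g xs -> fmin f g = (peval f xs)%:E.
Proof.
move=> [xsK xs_min]; apply/eqP; rewrite eq_le; apply/andP; split.
  by apply: ereal_inf_lbound; exists xs.
by apply: le_ereal_inf_tmp => _ [x xK <-]; rewrite lee_fin; exact: xs_min.
Qed.

(** The test point is the unit vector in the direction [(1, xs)]; dividing its
    constraint by [x_0 ^ d], where [x_0] is the inverse of the norm of
    [(1, xs)], produces the factor [(1 + |xs|^2)^(d/2)]. *)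
Lemma perturbed_feasible_le (R : realType) (n m p : nat)
    (f : {mpoly R[n]}) (g : 'I_m -> {mpoly R[n]})
    (X : 'I_p -> {set 'I_n}) (xs : 'rV[R]_n) (eps gamma B : R) :
  feasible g xs ->
  (forall x w, sparse_hfeasible g X (x, w) ->
     eps * (\sum_(i < n.+1) x ord0 i ^+ even_pdeg f
            + \sum_(l < p) w ord0 l ^+ even_pdeg f) <= B) ->
  perturbed_feasible f g X eps gamma ->
  gamma <= peval f xs + B * (1 + enorm xs ^+ 2) `^ ((pdeg f)%:R / 2).
Proof.
move=> xsK pert_le gammaP.
set y := lift_point xs; set d := pdeg f.
have y2 : enorm y ^+ 2 = 1 + enorm xs ^+ 2 by exact: enorm_sqr_lift_point.
have y2_gt0 : 0 < enorm y ^+ 2 by rewrite y2 ltr_pwDl // sqr_ge0.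
have N0 : 0 < enorm y by rewrite lt_def sqrtr_ge0 andbT -sqrf_eq0 gt_eqF.
have -> : (1 + enorm xs ^+ 2) `^ (d%:R / 2) = enorm y ^+ d.
  rewrite -y2 mulrC powRrM powR12_sqrt ?sqr_ge0 // sqrtr_sqr ger0_norm ?ltW //.
  by rewrite powR_mulrn // ltW.
set t := (enorm y)^-1; have t0 : 0 < t by rewrite invr_gt0.
have ty0 : (t *: y) ord0 ord0 = t by rewrite mxE lift_point0 mulr1.
have [|||w tyw] := @sparse_lift_exists R n m p g X (t *: y).
- by rewrite ty0 ltW.
- move=> j; rewrite peval_homogZ peval_homog_lift_point mulr_ge0 ?xsK //.
  by rewrite exprn_ge0 // ltW.
- by rewrite enorm_sqrZ exprVn mulVf // gt_eqF.
have := gammaP _ tyw; have := pert_le _ _ tyw.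
rewrite /= ty0 peval_homogZ peval_homog_lift_point -/d.
set S := eps * _ => SB.
rewrite subr_ge0 => le1.
rewrite -(ler_pM2r (exprn_gt0 d t0)); apply: (le_trans le1).
rewrite mulrDl -mulrA -exprMn divff ?expr1n ?mulr1 ?gt_eqF //.
by rewrite mulrC lerD2l.
Qed.

Theorem theorem3p1 (R : realType) (n m p : nat)
    (f : {mpoly R[n]}) (g : 'I_m -> {mpoly R[n]})
    (X : 'I_p -> {set 'I_n}) (xs : 'rV[R]_n)
    (fmin_bounded : (-oo < fmin f g)%E)
    (csp : is_csp f g X)
    (closedK : closed_at_infinity g)
    (xs_min : is_minimizer f g xs) :
  (forall eps : R, 0 < eps ->
     (fmin f g < perturbed_value f g X eps)%E
     (* for constant [f] one has [d0 = 0] and this bound fails *)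
     /\ ((0 < pdeg f)%N ->
         (perturbed_value f g X eps
          <= fmin f g
             + (eps * p%:R * (1 + enorm xs ^+ 2) `^ ((pdeg f)%:R / 2))%:E)%E))
  /\ perturbed_value f g X 0 = fmin f g.
Proof.
have [cover _ _] := csp; have [xsK xs_le] := xs_min.
have fminE := fmin_minimizer xs_min.
have cone := homog_ge_of_closed_at_infinity closedK xs_min.
have le_value eps gamma : perturbed_feasible f g X eps gamma ->
    (gamma%:E <= perturbed_value f g X eps)%E.
  by move=> h; apply: ereal_sup_ubound; exists gamma.
rewrite fminE; split=> [eps eps0|]; last first.
  apply/eqP; rewrite eq_le; apply/andP; split.
    apply: ge_ereal_sup => _ [gamma gammaP <-]; rewrite lee_fin.
    have := @perturbed_feasible_le R n m p f g X xs 0 gamma 0 xsK.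
    by rewrite mul0r addr0; apply=> // x w _; rewrite mul0r.
  apply: le_value => -[x w] [/= x0 gx _].
  by rewrite mul0r addr0 subr_ge0; exact: cone.
split=> [|d_gt0]; last first.
  apply: ge_ereal_sup => _ [gamma gammaP <-]; rewrite -EFinD lee_fin.
  apply: perturbed_feasible_le gammaP => //.
  move=> x w xw; rewrite ler_pM2l //.
  apply: perturbation_upper_bound xw => //; last by case: (pdeg f) d_gt0.
  exact: blocks_gt0_of_pdeg_gt0 cover d_gt0.
(* The supremum exceeds the minimum as soon as some value above it is
   admissible; by the cone inequality it is enough that the perturbation
   dominates a positive multiple of [x_0 ^ d]. *)
suff [delta delta0 deltaP] : exists2 delta : R, 0 < delta &
    forall x w, sparse_hfeasible g X (x, w) ->
      delta * x ord0 ord0 ^+ pdeg f <=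
      eps * (\sum_(i < n.+1) x ord0 i ^+ even_pdeg f
             + \sum_(l < p) w ord0 l ^+ even_pdeg f).
  apply: (@lt_le_trans _ _ (peval f xs + delta)%:E); first by rewrite lte_fin ltrDl.
  apply: le_value => -[x w] xw /=.
  have [/= x0 gx _] := xw.
  by rewrite subr_ge0 mulrDl lerD ?cone ?deltaP.
have [p0|p_gt0] := posnP p.
  (* Without blocks there are no variables and no sphere equations, but then
     [d = d0 = 0] and the term [x_0 ^ d0 = 1] alone is enough. *)
  have d0 : pdeg f = 0%N.
    apply/eqP; rewrite -leqn0 leqNgt; apply/negP => /(blocks_gt0_of_pdeg_gt0 cover).
    by rewrite lt0n => /eqP.
  exists eps => // x w _; rewrite /even_pdeg d0 ler_pM2l // big_ord_recl.
  by rewrite -addrA lerDl addr_ge0 // sumr_ge0.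
exists (eps * n.+2%:R^-1 ^+ uphalf (pdeg f)).
  by rewrite mulr_gt0 // exprn_gt0 // invr_gt0.
move=> x w xw; rewrite -mulrA ler_pM2l //.
apply: le_trans (perturbation_lower_bound (uphalf (pdeg f)) p_gt0 xw).
have [x0 _ _] := xw; rewrite ler_piMr ?exprn_ge0 ?invr_ge0 // exprn_ile1 //.
rewrite -(expr_le1 (isT : (0 < 2)%N) x0).
exact: (sparse_coord_sqr_le1 (l := Ordinal p_gt0) xw (finset.setU11 _ _)).
Qed.
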